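(* Let $G$ be a fixed bipartite graph with $|V(G)|=p\ge 3$ vertices and $|E(G)|=q$ edges. Then there exists a constant $C>0$ (depending on $G$) such that for all sufficiently large $n$, \[ \operatorname{br}(G,K_{n,n}) > C\left(\frac{n}{\log n}\right)^{(q-1)/(p-2)}. \]
   Context: For bipartite graphs $G_1,G_2$, the bipartite Ramsey number $\operatorname{br}(G_1,G_2)$ is the smallest integer $N$ such that every red/blue coloring of the edges of the complete bipartite graph $K_{N,N}$ contains a red copy of $G_1$ or a blue copy of $G_2$. $K_{n,n}$ denotes the complete bipartite graph with both parts of size $n$. Rounding (floors/ceilings) is ignored. *)

(* Defs.v *)
From mathcomp Require Import all_boot.
From Stdlib Require Import Reals.

Set Implicit Arguments.
Unset Strict Implicit.
Unset Printing Implicit Defensive.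

Definition simple_graph (T : finType) (e : rel T) : Prop :=
  (forall x y, e x y = e y x) /\ (forall x, ~~ e x x).

Definition bipartite (T : finType) (e : rel T) : Prop :=
  exists side : T -> bool, forall x y, e x y -> side x != side y.

Definition nverts (T : finType) : nat := #|T|.
Definition nedges (T : finType) (e : rel T) : nat :=
  #|[set xy : T * T | e xy.1 xy.2]| %/ 2.

Definition KV (N : nat) : finType := ('I_N + 'I_N)%type.

Definition Knn (n : nat) : rel (KV n) :=
  fun u v => match u, v with
             | inl _, inr _ => true
             | inr _, inl _ => true
             | _, _ => false
             end.

(* A red/blue colouring of the edges of K_{N,N}: the edge between left vertex
   i and right vertex j is red iff c i j = true, blue otherwise. *)
Definition colouring (N : nat) := 'I_N -> 'I_N -> bool.

Definition red_graph (N : nat) (c : colouring N) : rel (KV N) :=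
  fun u v => match u, v with
             | inl i, inr j => c i j
             | inr j, inl i => c i j
             | _, _ => false
             end.

Definition blue_graph (N : nat) (c : colouring N) : rel (KV N) :=
  fun u v => match u, v with
             | inl i, inr j => ~~ c i j
             | inr j, inl i => ~~ c i j
             | _, _ => false
             end.

Definition has_copy (T : finType) (e : rel T) (V : finType) (H : rel V) : Prop :=
  exists phi : T -> V, injective phi /\ forall x y, e x y -> H (phi x) (phi y).

(* N "arrows" (G1, G2): every red/blue colouring of K_{N,N} contains a red
   copy of G1 or a blue copy of G2.  br(G1,G2) is the least such N. *)
Definition br_arrows (T1 : finType) (e1 : rel T1) (T2 : finType) (e2 : rel T2)
  (N : nat) : Prop :=
  forall c : colouring N, has_copy e1 (red_graph c) \/ has_copy e2 (blue_graph c).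

(* br(G1,G2) > x  (x real): no N <= x has the arrow property, i.e. the least
   N with the arrow property (if any) is larger than x. *)
Definition br_gt (T1 : finType) (e1 : rel T1) (T2 : finType) (e2 : rel T2)
  (x : R) : Prop :=
  forall N : nat, (INR N <= x)%R -> ~ br_arrows e1 e2 N.

(* Main.v *)
(* Colour the edges of K_{N,N} with K+1 colours, two of which count as red, and
   let g(D) be the number of colourings having no red G and no blue K_{n,n}
   inside the edge set D. Rosenfeld's counting argument replaces the local lemma:
   by induction on |D|, (K+1) g(D + x) >= K g(D). Indeed a colouring that is good
   on D but not on D + x makes some forbidden copy A through x monochromatic; it
   is good on D \ A, a condition independent of the colours on A, and
   g(D \ A) <= ((K+1)/K)^(|A|-1) g(D) by induction. Hence a good colouring exists
   as soon as (number of copies of G through x) 2^q <= K^(q-1) / 2 and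
   (number of copies of K_{n,n}) (K-1)^(n^2) <= K^(n^2-1) / 2. Both hold for
   K of order n / ln n and N <= C (n / ln n)^((q-1)/(p-2)). *)
Require Import Defs.
From mathcomp Require Import all_boot.
From Stdlib Require Import Reals Lra.
(* Reals rebinds [^] in nat_scope; importing ssrnat again restores [expn]. *)
From mathcomp Require Import ssrnat zify.

Set Implicit Arguments.
Unset Strict Implicit.
Unset Printing Implicit Defensive.

(** * Counting colourings: independence of coordinates *)

Definition depends_on (I C : finType) (D : {set I}) (Q : pred {ffun I -> C}) :=
  forall f g : {ffun I -> C}, {in D, f =1 g} -> Q f = Q g.

Definition maps_into (I C : finType) (S : {set C}) (A : {set I})
  (f : {ffun I -> C}) : bool := [forall x in A, f x \in S].

Definition avoids (I C : finType) (F : {set {set I}}) (S : {set C})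
  (D : {set I}) (f : {ffun I -> C}) : bool :=
  [forall A in F, (A \subset D) ==> ~~ maps_into S A f].

(** Overwriting the value at [x] injects any fibre [f x = c] into any other fibre [f x = d] and
    preserves [Q], so all fibres have the same size. Independence is stated cross-multiplied, which
    keeps probabilities inside [nat]. *)
Lemma card_coord (I C : finType) (Q : pred {ffun I -> C}) (x : I) (S : {set C}) :
  depends_on [set~ x] Q ->
  #|[set f | Q f & f x \in S]| * #|C| = #|[set f | Q f]| * #|S|.
Proof.
move=> Qx; pose K c := #|[set f : {ffun I -> C} | Q f & f x == c]|.
have cardS (S' : {set C}) : #|[set f | Q f & f x \in S']| = \sum_(c in S') K c.
  rewrite -sum1_card (partition_big (fun f : {ffun I -> C} => f x) (mem S')) /=;
    last by move=> f; rewrite inE => /andP[].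
  apply: eq_bigr => c cS; rewrite /K -sum1_card; apply: eq_bigl => f.
  by rewrite !inE; case: eqP => [->|_]; rewrite ?cS ?andbT ?andbF.
have leK c d : K c <= K d.
  pose upd (f : {ffun I -> C}) := [ffun y => if y == x then d else f y].
  rewrite /K -(card_in_imset (f := upd)) => [|f g]; last first.
    rewrite !inE => /andP[_ /eqP fx] /andP[_ /eqP gx] /ffunP eq_fg.
    apply/ffunP => y; have:= eq_fg y; rewrite !ffunE.
    by case: eqP => // -> _; rewrite fx gx.
  apply/subset_leq_card/subsetP => g /imsetP[f]; rewrite !inE => /andP[Qf _] ->.
  rewrite ffunE eqxx eqxx andbT -(Qx f) // => y.
  by rewrite !inE ffunE => /negPf ->.
have eqK c d : K c = K d by apply/eqP; rewrite eqn_leq !leK.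
have -> : [set f | Q f] = [set f | Q f & f x \in [set: C]].
  by apply/setP=> f; rewrite !inE andbT.
rewrite !cardS [RHS]mulnC -sum_nat_const big_distrl /=.
apply: eq_bigr => c _; rewrite -cardsT mulnC -sum_nat_const.
apply: eq_bigr => d _; exact: eqK.
Qed.

Lemma maps_into_setU1 (I C : finType) (S : {set C}) (A : {set I}) x f :
  maps_into S (x |: A) f = (f x \in S) && maps_into S A f.
Proof.
apply/forall_inP/andP => [h|[fx /forall_inP fA] y].
  split; first by apply: h; rewrite setU11.
  by apply/forall_inP => y yA; apply: h; rewrite setU1r.
by rewrite in_setU1 => /predU1P[->|/fA].
Qed.

Lemma depends_maps_into (I C : finType) (S : {set C}) (A : {set I}) :
  depends_on A (maps_into S A).
Proof. by move=> f g fg; apply: eq_forallb_in => x xA; rewrite fg. Qed.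

(** Elements of [A] are peeled off one at a time, with [card_coord] applied to [Q] joined with the
    constraint on the rest of [A]. *)
Lemma card_maps_into (I C : finType) (S : {set C}) (A : {set I})
    (Q : pred {ffun I -> C}) :
  depends_on (~: A) Q ->
  #|[set f | Q f & maps_into S A f]| * #|C| ^ #|A| = #|[set f | Q f]| * #|S| ^ #|A|.
Proof.
move: {2}#|A| (erefl #|A|) => m; elim: m A => [|m IH] A cA QA.
  move/eqP: (cA); rewrite cards_eq0 => /eqP A0; rewrite cA !muln1.
  apply: eq_card => f; rewrite !inE; case: (Q f) => //=.
  by apply/forall_inP => x; rewrite A0 inE.
have /card_gt0P[x xA] : 0 < #|A| by rewrite cA.
have cA' : #|A :\ x| = m by move: cA; rewrite (cardsD1 x) xA => -[].
have QA' : depends_on (~: (A :\ x)) Q.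
  by move=> f g fg; apply: QA => y yA; apply: fg; move: yA; rewrite !inE => /negPf->; rewrite andbF.
have := IH _ cA' QA'; rewrite cA' cA !expnS => IHx.
have := @card_coord I C (fun f => Q f && maps_into S (A :\ x) f) x S.
have -> : [set f | Q f && maps_into S (A :\ x) f & f x \in S]
        = [set f | Q f & maps_into S A f].
  by apply/setP => f; rewrite !inE -[in RHS](setD1K xA) maps_into_setU1 -andbA
    [(_ \in S) && _]andbC.
move=> H; rewrite mulnA H; first by rewrite mulnAC IHx mulnAC mulnA.
move=> f g fg; congr andb.
  by apply: QA => y; rewrite inE => yA; apply: fg; rewrite !inE; apply: contraNneq yA => ->.
by apply: depends_maps_into => y; rewrite !inE => /andP[yx _]; apply: fg; rewrite !inE.
Qed.

(** * Rosenfeld's counting induction *)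

Lemma depends_avoids (I C : finType) (F : {set {set I}}) (S : {set C}) D :
  depends_on D (avoids F S D).
Proof.
move=> f g fg; apply: eq_forallb_in => A AF.
case: (boolP (A \subset D)) => //= /subsetP AD; congr negb.
by apply: depends_maps_into => x /AD /fg.
Qed.

Lemma avoidsS (I C : finType) (F : {set {set I}}) (S : {set C}) (D D' : {set I}) f :
  D' \subset D -> avoids F S D f -> avoids F S D' f.
Proof.
move=> sD /forall_inP h; apply/forall_inP => A /h /implyP hA.
by apply/implyP => /subset_trans /(_ sD).
Qed.

(** The loss caused by one family when [x] is added. [P] stays abstract because goodness refers to
    both families, and [growP] is the induction hypothesis already iterated. The factor 2 in the
    last hypothesis lets each family spoil at most a fraction [1 / (2 #|C|)] of the good
    colourings. *)
Lemma card_new_events (I C : finType) (P : {set I} -> pred {ffun I -> C})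
    (F : {set {set I}}) (S : {set C}) (D : {set I}) (x : I) (q a K : nat) :
  (forall D', depends_on D' (P D')) ->
  (forall (D' : {set I}) f, D' \subset D -> P D f -> P D' f) ->
  (forall D' : {set I}, D' \subset D ->
     #|[set f | P D' f]| * K ^ #|D :\: D'| <= #|[set f | P D f]| * #|C| ^ #|D :\: D'|) ->
  x \notin D -> 0 < K -> 0 < #|C| ->
  {in F, forall A : {set I}, #|A| = q.+1} ->
  #|[set A : {set I} in F | x \in A]| <= a ->
  2 * a * #|S| ^ q.+1 <= K ^ q ->
  2 * #|[set f | P D f & [exists (A : {set I} | A \in F),
           [&& x \in A, A \subset x |: D & maps_into S A f]]]| * #|C|
    <= #|[set f | P D f]|.
Proof.
move=> depP monoP growP xD K0 C0 cF ca hK.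
set X := [set f | _ & _]; set g := #|[set f | P D f]|.
pose B A := [set f | P D f & maps_into S A f].
pose FD := [set A : {set I} in F | (x \in A) && (A \subset x |: D)].
have leX : #|X| <= \sum_(A in FD) #|B A|.
  have /subset_leq_card h : X \subset \bigcup_(A in FD) B A.
    apply/subsetP => f; rewrite inE => /andP[Pf /exists_inP[A AF /and3P[xA AD fA]]].
    by apply/bigcupP; exists A; rewrite !inE ?AF ?xA ?Pf.
  apply: leq_trans h _; elim/big_ind2: _ => [|U m V n Um Vn|A _]; rewrite ?cards0 //.
  by apply: leq_trans (leq_add Um Vn); apply: leq_card_setU.
have leB A : A \in FD -> #|B A| * (#|C| * K ^ q) <= g * #|S| ^ q.+1.
  rewrite inE => /and3P[AF xA AD].
  have cA := cF A AF.
  (* Since [x] is in [A] but not in [D], removing [A] from [D] deletes only [q] of its [q.+1]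
     elements. *)
  have cDA : #|D :\: (D :\: A)| = q.
    have -> : D :\: (D :\: A) = A :\ x.
      apply/setP => y; rewrite !inE; have /subsetP/(_ y) := AD; rewrite !inE.
      case: (y \in A) => //=; last by rewrite andbF; case: (y \in D).
      move=> /(_ isT); case: eqP => [->|_] /=; rewrite ?(negPf xD) //.
    by move: cA; rewrite (cardsD1 x) xA => -[].
  have := growP (D :\: A) (subsetDl _ _); rewrite cDA -/g => grow.
  (* Goodness is weakened from [D] to [D :\: A], where it no longer sees the colours on [A]; the two
     conditions become independent. *)
  have leBA : #|B A| * #|C| ^ q.+1 <= #|[set f | P (D :\: A) f]| * #|S| ^ q.+1.
    rewrite -cA -card_maps_into; last first.
      by move=> f h fh; apply: depP => y; rewrite inE => /andP[yA _]; apply: fh; rewrite inE.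
    rewrite leq_mul2r; apply/orP; right; apply/subset_leq_card/subsetP => f.
    by rewrite !inE => /andP[Pf ->]; rewrite andbT; apply: monoP Pf; rewrite subsetDl.
  rewrite -(leq_pmul2r (m := #|C| ^ q)) ?expn_gt0 ?C0 //.
  have -> : #|B A| * (#|C| * K ^ q) * #|C| ^ q = #|B A| * #|C| ^ q.+1 * K ^ q.
    by rewrite expnS; lia.
  apply: leq_trans (leq_mul leBA (leqnn _)) _.
  by rewrite mulnAC [leqRHS]mulnAC leq_mul2r grow orbT.
have leX' : #|X| * (#|C| * K ^ q) <= a * (g * #|S| ^ q.+1).
  apply: leq_trans (leq_mul leX (leqnn _)) _; rewrite big_distrl /=.
  apply: (@leq_trans (\sum_(A in FD) g * #|S| ^ q.+1)); first exact: leq_sum. 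
  rewrite sum_nat_const leq_mul2r.
  apply/orP; right; apply: leq_trans ca; apply/subset_leq_card/subsetP => A.
  by rewrite !inE => /and3P[-> ->].
rewrite -(leq_pmul2r (m := K ^ q)) ?expn_gt0 ?K0 //.
apply: leq_trans (leq_mul (leqnn g) hK).
by move: leX'; lia.
Qed.

Lemma avoids_both (I C : finType) (F1 F2 : {set {set I}}) (S1 S2 : {set C})
    (q1 q2 a1 a2 K : nat) :
  #|C| = K.+1 -> 0 < K ->
  {in F1, forall A : {set I}, #|A| = q1.+1} -> {in F2, forall A : {set I}, #|A| = q2.+1} ->
  (forall x, #|[set A : {set I} in F1 | x \in A]| <= a1) ->
  (forall x, #|[set A : {set I} in F2 | x \in A]| <= a2) ->
  2 * a1 * #|S1| ^ q1.+1 <= K ^ q1 ->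
  2 * a2 * #|S2| ^ q2.+1 <= K ^ q2 ->
  exists f : {ffun I -> C}, avoids F1 S1 setT f && avoids F2 S2 setT f.
Proof.
move=> cC K0 cF1 cF2 ca1 ca2 h1 h2.
pose P D (f : {ffun I -> C}) := avoids F1 S1 D f && avoids F2 S2 D f.
pose g D := #|[set f | P D f]|.
have depP D : depends_on D (P D).
  by move=> f h fh; congr andb; apply: depends_avoids fh.
have monoP (D D' : {set I}) f : D' \subset D -> P D f -> P D' f.
  by move=> sD /andP[/(avoidsS sD) f1 /(avoidsS sD) f2]; apply/andP.
have C0 : 0 < #|C| by rewrite cC.
pose bad (F : {set {set I}}) (S : {set C}) D x := [set f | P D f & [exists (A : {set I} | A \in F),
           [&& x \in A, A \subset x |: D & maps_into S A f]]].
have avoidsU1 F S D x f : P D f -> avoids F S D f -> f \notin bad F S D x ->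
    avoids F S (x |: D) f.
  move=> Pf /forall_inP aD; rewrite inE Pf /= => /exists_inPn aX.
  apply/forall_inP => A AF; apply/implyP => AD.
  have := aX A AF; rewrite AD /=; case: (boolP (x \in A)) => //= xA _.
  apply: (implyP (aD A AF)); apply/subsetP => y yA.
  by have /subsetP/(_ y yA) := AD; rewrite in_setU1 => /predU1P[yx|//]; rewrite -yx yA in xA.
have step (D : {set I}) x : x \notin D -> g D * K <= g (x |: D) * #|C|.
  move: {2}#|D|.+1 (ltnSn #|D|) => m; elim: m D x => // m IH D x cD xD.
  (* The elements of [D :\: D'] are added one by one. Every set extended on the way is a proper
     subset of [D], so the strong induction hypothesis applies to it. *)
  have grow (D' : {set I}) : D' \subset D -> g D' * K ^ #|D :\: D'| <= g D * #|C| ^ #|D :\: D'|.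
    move Dk: #|D :\: D'| => k; elim: k D' Dk => [|k IHk] D' ck sD.
      have <- : D' = D; last by rewrite !muln1.
      by apply/eqP; rewrite eqEsubset sD -setD_eq0 -cards_eq0 ck.
    have /card_gt0P[y] : 0 < #|D :\: D'| by rewrite ck.
    rewrite inE => /andP[yD' yD].
    have cD' : #|D'| < m.
      rewrite ltnS in cD; apply: leq_trans cD; apply: proper_card.
      by rewrite properE sD; apply/subsetPn; exists y.
    have ck' : #|D :\: (y |: D')| = k.
      have -> : D :\: (y |: D') = (D :\: D') :\ y.
        by apply/setP => z; rewrite !inE negb_or andbA.
      by move: ck; rewrite (cardsD1 y) inE yD yD' => -[].
    have sD' : y |: D' \subset D by rewrite subUset sub1set yD.
    have h1' := IH D' y cD' yD'; have h2' := IHk _ ck' sD'.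
    rewrite !expnS mulnA; apply: leq_trans (leq_mul h1' (leqnn _)) _.
    by rewrite mulnAC [leqRHS]mulnCA [leqRHS]mulnC leq_mul2r h2' orbT.
  have b1 := card_new_events depP (fun D' f s => monoP D D' f s) grow xD K0 C0 cF1 (ca1 x) h1.
  have b2 := card_new_events depP (fun D' f s => monoP D D' f s) grow xD K0 C0 cF2 (ca2 x) h2.
  rewrite -/(g D) in b1 b2.
  have split : g D <= g (x |: D) + (#|bad F1 S1 D x| + #|bad F2 S2 D x|).
    have /subset_leq_card le : [set f | P D f] \subset
        [set f | P (x |: D) f] :|: (bad F1 S1 D x :|: bad F2 S2 D x).
      apply/subsetP => f; rewrite inE !in_setU => Pf; have /andP[f1 f2] := Pf.
      case: (boolP (f \in bad F1 S1 D x)) => [_|n1]; first by rewrite /= orbT.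
      case: (boolP (f \in bad F2 S2 D x)) => [_|n2]; first by rewrite /= orbT.
      by rewrite orbF inE /P !avoidsU1.
    apply: leq_trans le (leq_trans (leq_card_setU _ _) _).
    by rewrite leq_add2l (leq_card_setU _ _).
  rewrite -/(bad F1 S1 D x) -/(bad F2 S2 D x) in b1 b2.
  (* After multiplication by [#|C|], the two bad sets together account for at most [g D], which is
     exactly the gap between [g D * #|C|] and [g D * K]. *)
  have := leq_mul split (leqnn #|C|); rewrite !mulnDl.
  have : g D * #|C| = g D * K + g D by rewrite cC mulnS addnC.
  by move: b1 b2; lia.
(* On the empty set every colouring is good because forbidden sets are nonempty; [step] and [0 < K]
   carry positivity upwards. *)
have gpos D : 0 < g D.
  move: {2}#|D| (erefl #|D|) => m; elim: m D => [|m IH] D cD.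
    have /card_gt0P[c _] : 0 < #|[set: C]| by rewrite cardsT.
    apply/card_gt0P; exists [ffun=> c]; rewrite inE.
    move/eqP: cD; rewrite cards_eq0 => /eqP ->.
    by apply/andP; split; apply/forall_inP => A AF; apply/implyP; rewrite subset0
      -cards_eq0 ?(cF1 A AF) ?(cF2 A AF).
  have /card_gt0P[x xD] : 0 < #|D| by rewrite cD.
  have cD' : #|D :\ x| = m by move: cD; rewrite (cardsD1 x) xD => -[].
  have := step (D :\ x) x; rewrite setD1K // !inE eqxx => /(_ isT).
  have := IH _ cD'; case: (g D) => //; rewrite mul0n leqn0 muln_eq0.
  by case: (g _) K0 => // ? ; case: (K).
have /card_gt0P[f] := gpos setT.
by rewrite inE => Pf; exists f.
Qed.

(** * Copies of a graph as edge sets, and reduction to two inequalities *)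

Definition embeds (T : finType) (e : rel T) N (phi : {ffun T -> KV N}) : bool :=
  injectiveb phi && [forall x, forall y, e x y ==> Knn (phi x) (phi y)].

(** Each edge is recorded once, as a (left, right) pair, although [e] contains both orientations;
    these pairs are the coordinates that get coloured. *)
Definition edge_image (T : finType) (e : rel T) N (phi : {ffun T -> KV N}) :
    {set 'I_N * 'I_N} :=
  [set ij | [exists xy : T * T,
     [&& e xy.1 xy.2, phi xy.1 == inl ij.1 & phi xy.2 == inr ij.2]]].

Definition copies (T : finType) (e : rel T) N : {set {set 'I_N * 'I_N}} :=
  [set edge_image e phi | phi in [set phi | embeds e phi]].

(** Every edge of a copy joins the two sides, so exactly one of its orientations starts on the left.
    Swapping exchanges [EL] with its complement in [E], which accounts for the halving in
    [nedges]. *)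
Lemma card_edge_image (T : finType) (e : rel T) N (phi : {ffun T -> KV N}) :
  (forall x y, e x y = e y x) -> embeds e phi -> #|edge_image e phi| = nedges e.
Proof.
move=> esym /andP[/injectiveP phi_inj /forallP phi_hom].
have hom x y : e x y -> Knn (phi x) (phi y).
  by have /forallP/(_ y)/implyP := phi_hom x.
pose L u := if u : KV N is inl _ then true else false.
pose E := [set xy : T * T | e xy.1 xy.2].
pose EL := [set xy in E | L (phi xy.1)].
pose swap (xy : T * T) := (xy.2, xy.1).
have swapK : involutive swap by case.
have cR : #|E :\: EL| = #|EL|.
  rewrite -(card_imset _ (inv_inj swapK)); congr #|pred_of_set _|.
  apply/setP => -[x y]; rewrite !inE /=; apply/imsetP/idP => [[[a b]]|].
    rewrite !inE /= => /andP[+ eab] [-> ->]; rewrite eab esym eab /=.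
    by move: (hom _ _ eab); case: (phi a) => i; case: (phi b) => j.
  move=> /andP[exy Lx]; exists (y, x) => //; rewrite !inE /= esym exy /= andbT.
  by move: (hom _ _ exy) Lx; case: (phi x) => i; case: (phi y) => j.
have -> : nedges e = #|EL|.
  rewrite /nedges -/E -(cardsID EL E) cR.
  have -> : E :&: EL = EL by apply/setIidPr/subsetP => xy; rewrite inE => /andP[].
  by rewrite addnn -muln2 mulnK.
(* Both sets are sent into pairs of vertices of [KV N], where their images coincide. *)
pose g (ij : 'I_N * 'I_N) : KV N * KV N := (inl ij.1, inr ij.2).
have g_inj : injective g by move=> [i j] [k l] [-> ->].
pose Phi (xy : T * T) := (phi xy.1, phi xy.2).
have Phi_inj : injective Phi by move=> [x y] [z w] [/phi_inj-> /phi_inj->].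
rewrite -(card_imset _ g_inj) -[RHS](card_imset _ Phi_inj).
congr #|pred_of_set _|; apply/setP => uv; apply/imsetP/imsetP.
  move=> [[i j]]; rewrite inE => /existsP[[x y] /and3P[/= exy /eqP px /eqP py]] ->.
  by exists (x, y); rewrite ?inE /= ?exy ?px //= /Phi /= px py.
move=> [[x y]]; rewrite !inE /= => /andP[exy].
rewrite /Phi /=; case px : (phi x) => [i|i] //; case py : (phi y) (hom _ _ exy) => [j|j];
  rewrite px //= => _ _ ->.
exists (i, j) => //; rewrite inE; apply/existsP; exists (x, y).
by rewrite exy px py !eqxx.
Qed.

Lemma card_two_values (T C : finType) (x y : T) (u v : C) : x != y ->
  #|[set f : {ffun T -> C} | f x == u & f y == v]| * #|C| ^ 2 = #|C| ^ #|T|.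
Proof.
move=> xy; pose Q (f : {ffun T -> C}) := f x \in [set u].
have cy : #|[set f | Q f & f y \in [set v]]| * #|C| = #|[set f | Q f]|.
  by rewrite card_coord ?cards1 ?muln1 // => f g fg; rewrite /Q fg // !inE.
have cx : #|[set f : {ffun T -> C} | xpredT f & f x \in [set u]]| * #|C| = #|C| ^ #|T|.
  rewrite card_coord // cards1 muln1 -card_ffun -cardsT.
  by apply: eq_card => f; rewrite !inE.
rewrite expnS expn1 mulnA -[RHS]cx; congr (_ * _).
have -> : [set f : {ffun T -> C} | f x == u & f y == v] = [set f | Q f & f y \in [set v]].
  by apply/setP => f; rewrite !inE /Q inE.
by rewrite cy; apply: eq_card => f; rewrite !inE.
Qed.

(** Some ordered edge of [e] is sent onto [ij]: at most [#|T| ^ 2] choices. This fixes two distinct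
    vertices, and the others are placed arbitrarily among [N + N], injectivity being dropped. *)
Lemma card_copies_through (T : finType) (e : rel T) N ij :
  irreflexive e ->
  #|[set A in copies e N | ij \in A]| <= #|T| ^ 2 * (N + N) ^ (#|T| - 2).
Proof.
move=> eirr; case: ij => i j.
pose X (xy : T * T) := [set f : {ffun T -> KV N} | f xy.1 == inl i & f xy.2 == inr j].
have le : #|[set A in copies e N | (i, j) \in A]| <= #|\bigcup_(xy | e xy.1 xy.2) X xy|.
  apply: leq_trans (leq_imset_card (@edge_image T e N) _).
  apply/subset_leq_card/subsetP => A; rewrite inE => /andP[/imsetP[phi phiP ->]].
  rewrite inE => /existsP[xy /and3P[exy p1 p2]]; apply: imset_f.
  by apply/bigcupP; exists xy; rewrite // inE p1 p2.
apply: leq_trans le (@leq_trans (\sum_(xy : T * T | e xy.1 xy.2) #|X xy|) _ _ _ _).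
  elim/big_ind2: _ => [|U m V n Um Vn|A _]; rewrite ?cards0 //.
  by apply: leq_trans (leq_add Um Vn); apply: leq_card_setU.
have N0 : 0 < N + N by rewrite addn_gt0 (leq_ltn_trans (leq0n i) (ltn_ord i)).
have leX xy : e xy.1 xy.2 -> #|X xy| <= (N + N) ^ (#|T| - 2).
  case: xy => x y /= exy.
  have xy : x != y by apply: contraTneq exy => ->; rewrite eirr.
  have T2 : 1 < #|T| by apply/card_gt1P; exists x, y.
  have := @card_two_values T (KV N) x y (inl i) (inr j) xy.
  rewrite card_sum card_ord -[X in _ = _ ^ X](subnK T2) expnD => /eqP.
  by rewrite eqn_pmul2r ?expn_gt0 ?N0 // => /eqP <-.
apply: (@leq_trans (\sum_(xy : T * T | e xy.1 xy.2) (N + N) ^ (#|T| - 2))).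
  exact: leq_sum.
rewrite sum_nat_const leq_mul2r.
by apply/orP; right; rewrite -mulnn -card_prod max_card.
Qed.

Lemma nedges_Knn n : nedges (@Knn n) = n * n.
Proof.
pose g (ij : 'I_n * 'I_n) : KV n * KV n := (inl ij.1, inr ij.2).
pose h (ij : 'I_n * 'I_n) : KV n * KV n := (inr ij.1, inl ij.2).
have g_inj : injective g by move=> [i j] [k l] [-> ->].
have h_inj : injective h by move=> [i j] [k l] [-> ->].
have -> : nedges (@Knn n) = #|(g @: setT) :|: (h @: setT)| %/ 2.
  congr (_ %/ 2); apply: eq_card => -[[i|i] [j|j]]; rewrite !inE /=; apply/esym.
  - by apply/norP; split; apply/imsetP => -[].
  - by apply/orP; left; apply/imsetP; exists (i, j).
  - by apply/orP; right; apply/imsetP; exists (i, j).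
  - by apply/norP; split; apply/imsetP => -[].
rewrite cardsU !card_imset // (_ : _ :&: _ = set0) ?cards0 ?subn0; last first.
  by apply/setP => uv; rewrite !inE; apply/andP => -[/imsetP[ij _ ->] /imsetP[]].
by rewrite cardsT card_prod card_ord addnn -muln2 mulnK.
Qed.

(** Here [H] stands for the red or the blue graph and [S] for the palette of its edges. *)
Lemma avoids_no_copy (T C : finType) (e : rel T) N (H : rel (KV N)) (S : {set C})
    (f : {ffun 'I_N * 'I_N -> C}) :
  subrel H (@Knn N) -> (forall i j, H (inl i) (inr j) -> f (i, j) \in S) ->
  avoids (copies e N) S setT f -> ~ has_copy e H.
Proof.
move=> HK HS /forall_inP av [phi [phi_inj phi_hom]].
have emb : embeds e (finfun phi).
  apply/andP; split; first by apply/injectiveP => x y; rewrite !ffunE => /phi_inj.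
  by apply/forallP => x; apply/forallP => y; apply/implyP => /phi_hom /HK; rewrite !ffunE.
have := av (edge_image e (finfun phi)); rewrite subsetT implyTb imset_f ?inE //.
move=> /(_ isT)/negP; apply; apply/forall_inP => -[i j].
rewrite inE => /existsP[[x y] /and3P[/= /phi_hom exy]]; rewrite !ffunE => /eqP px /eqP py.
by apply: HS; rewrite -px -py.
Qed.

Lemma not_br_arrows_Knn (T : finType) (e : rel T) N n K :
  simple_graph e -> 0 < nedges e -> 0 < n -> 0 < K ->
  2 * (#|T| ^ 2 * (N + N) ^ (#|T| - 2)) * 2 ^ nedges e <= K ^ (nedges e - 1) ->
  2 * (N + N) ^ (n + n) * (K - 1) ^ (n * n) <= K ^ (n * n - 1) ->
  ~ br_arrows e (@Knn n) N.
Proof.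
move=> [esym eirr] q0 n0 K0 h1 h2 arr.
have eirr' : irreflexive e by move=> x; rewrite (negbTE (eirr x)).
have nn0 : 0 < n * n by rewrite muln_gt0 n0.
(* Two of the [K.+1] colours are red, leaving [K - 1] blue ones. With a single red colour the blue
   inequality would have [K ^ (n * n)] on its left and fail for [N > 0]. *)
pose S : {set 'I_K.+1} := [set ord0; ord_max].
have cS : #|S| = 2 by rewrite cards2 -val_eqE /= eq_sym -lt0n K0.
have cSC : #|~: S| = K - 1.
  by have := cardsC S; rewrite cS card_ord => h; apply/eqP; rewrite -(eqn_add2l 2) h; lia.
have avoider := @avoids_both ('I_N * 'I_N)%type 'I_K.+1 (copies e N) (copies (@Knn n) N) S (~: S)
  (nedges e - 1) (n * n - 1) (#|T| ^ 2 * (N + N) ^ (#|T| - 2)) ((N + N) ^ (n + n)) K.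
have q1 : (nedges e - 1).+1 = nedges e by rewrite subn1 prednK.
have nn1 : (n * n - 1).+1 = n * n by rewrite subn1 prednK.
rewrite card_ord cS cSC q1 nn1 in avoider.
have [||||f /andP[av1 av2]] := avoider erefl K0 _ _ _ _ h1 h2.
- by move=> A /imsetP[phi + ->]; rewrite inE => emb; apply: card_edge_image.
- move=> A /imsetP[phi + ->]; rewrite inE => emb; rewrite -nedges_Knn.
  by apply: card_edge_image emb => -[x|x] [y|y].
- by move=> ij; apply: card_copies_through.
(* For blue copies the crude bound by the number of all maps from [KV n] to [KV N] suffices. *)
- move=> ij; apply: (@leq_trans #|copies (@Knn n) N|).
    by apply/subset_leq_card/subsetP => A; rewrite inE => /andP[].
  apply: leq_trans (leq_imset_card _ _) _; apply: leq_trans (max_card _) _.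
  by rewrite card_ffun !card_sum !card_ord.
case: (arr (fun i j => f (i, j) \in S)).
  by apply: avoids_no_copy av1 => [[i|i] [j|j]|i j] /=.
by apply: avoids_no_copy av2 => [[i|i] [j|j]|i j] /=; rewrite ?inE.
Qed.

(** * Real estimates *)

Lemma INR_expn m k : INR (m ^ k) = (INR m ^ k)%R.
Proof. by elim: k => // k IH; rewrite expnS mult_INR IH. Qed.

Lemma exp_le x y : (x <= y)%R -> (exp x <= exp y)%R.
Proof. by case=> [/exp_increasing/Rlt_le|->] //; apply: Rle_refl. Qed.

Lemma ln_le x y : (0 < x)%R -> (x <= y)%R -> (ln x <= ln y)%R.
Proof. by move=> x0 [/(ln_increasing _ _ x0)/Rlt_le|->] //; apply: Rle_refl. Qed.

Lemma exp_INR_mult k x : (exp (INR k * x) = exp x ^ k)%R.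
Proof.
elim: k => [|k IH]; first by rewrite Rmult_0_l exp_0.
by rewrite S_INR Rmult_plus_distr_r Rmult_1_l exp_plus IH Rmult_comm.
Qed.

Lemma leq_INR m k : (INR m <= INR k)%R -> m <= k.
Proof. by move=> h; apply/leP/INR_le. Qed.

(** Comes from [1 + t <= exp t] at [t = ln (sqrt x)]; it serves to make [n / ln n] large
    explicitly. *)
Lemma ln_le_double_sqrt x : (0 < x)%R -> (ln x <= 2 * sqrt x)%R.
Proof.
move=> x0; have s0 := sqrt_lt_R0 _ x0.
rewrite -{1}(sqrt_sqrt x); last lra.
have := exp_ineq1_le (ln (sqrt x)); rewrite exp_ln // ln_mult //; lra.
Qed.

Lemma ln_ge1 x : (3 <= x)%R -> (1 <= ln x)%R.
Proof.
move=> x3; rewrite -(ln_exp 1).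
by apply: ln_le; [exact: exp_pos | move: exp_le_3; lra].
Qed.

Lemma nat_floor_half x : (2 <= x)%R -> exists K : nat, (x / 2 <= INR K <= x)%R.
Proof.
move=> x2; have [h1 h2] := base_Int_part x.
have pos : (0 <= Int_part x)%Z by apply: le_IZR; have : (1 < IZR (Int_part x))%R; lra.
exists (Z.to_nat (Int_part x)); rewrite INR_IZR_INZ Znat.Z2Nat.id //; lra.
Qed.

(** The hypothesis is the logarithmic form of the inequality, through
    [(1 - 1/K) ^ (n * n) <= exp (- n * n / K)]. *)
Lemma blue_count_le (N n K : nat) : 0 < n -> 0 < K -> 0 < N ->
  (ln (INR (2 * K)) + INR (n + n) * ln (INR (N + N)) <= INR (n * n) / INR K)%R ->
  2 * (N + N) ^ (n + n) * (K - 1) ^ (n * n) <= K ^ (n * n - 1).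
Proof.
move=> n0 K0 N0 h.
have nn0 : 0 < n * n by rewrite muln_gt0 n0.
(* Multiplying by [K] removes the exponent [n * n - 1]. *)
suff : 2 * K * (N + N) ^ (n + n) * (K - 1) ^ (n * n) <= K ^ (n * n).
  have KE : K * K ^ (n * n - 1) = K ^ (n * n) by rewrite -expnS subn1 prednK.
  by move=> h'; rewrite -(leq_pmul2l K0) KE !mulnA [K * 2]mulnC.
have rK : (0 < INR K)%R by apply: lt_0_INR; apply/ltP.
have rK2 : (0 < INR (2 * K))%R by apply: lt_0_INR; apply/ltP; lia.
have rN : (0 < INR (N + N))%R by apply: lt_0_INR; apply/ltP; lia.
apply: leq_INR; rewrite !mult_INR !INR_expn.
have -> : INR (K - 1) = (INR K * (1 - / INR K))%R.
  by rewrite minus_INR; [rewrite /=; field; lra | apply/leP].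
rewrite Rpow_mult_distr.
have pK : (0 < INR K ^ (n * n))%R by apply: pow_lt.
set P := ((1 - / INR K) ^ (n * n))%R.
have P_le : (P <= exp (- (INR (n * n) / INR K)))%R.
  have -> : (- (INR (n * n) / INR K) = INR (n * n) * - / INR K)%R by field; lra.
  rewrite exp_INR_mult; apply: pow_incr; split.
    have : (1 <= INR K)%R by apply: (le_INR 1); apply/leP.
    by move=> K1; have := Rinv_le_contravar 1 (INR K); rewrite Rinv_1; lra.
  by have := exp_ineq1_le (- / INR K); lra.
have Q_eq : (INR (2 * K) * INR (N + N) ^ (n + n)
    = exp (ln (INR (2 * K)) + INR (n + n) * ln (INR (N + N))))%R.
  by rewrite exp_plus exp_ln // exp_INR_mult exp_ln.
have P0 : (INR (2 * K) * INR (N + N) ^ (n + n) * P <= 1)%R.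
  rewrite Q_eq; apply: Rle_trans (Rmult_le_compat_l _ _ _ _ P_le) _.
    exact/Rlt_le/exp_pos.
  rewrite -exp_plus -exp_0; apply: exp_le; lra.
have := Rmult_le_compat_l _ _ _ (Rlt_le _ _ pK) P0.
by rewrite !mult_INR; lra.
Qed.

(** * Choice of parameters *)

Lemma not_br_arrows0 (T : finType) (e : rel T) n :
  0 < #|T| -> 0 < n -> ~ br_arrows e (@Knn n) 0.
Proof.
move=> /card_gt0P[x _] n0 arr.
have empty (u : KV 0) : False by case: u => -[].
case: (arr (fun _ _ => true)) => -[phi _]; first exact: empty (phi x).
exact: empty (phi (inl (Ordinal n0))).
Qed.

(* [s] is the exponent of the theorem; [c] is chosen so that [n / K >= c ln n]
   beats the [2 s ln n] per vertex coming from the number of blue copies. *)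
Lemma not_br_arrows_large (T : finType) (e : rel T) (s c : R) N n :
  simple_graph e -> 3 <= #|T| -> 0 < nedges e ->
  (s * (INR #|T| - 2) = INR (nedges e) - 1)%R -> c = (2 * (s + 2))%R ->
  0 < N -> 3 <= n -> (16 * c ^ 2 <= INR n)%R ->
  (INR N <= / (INR (2 * #|T| ^ 2 * 2 ^ (#|T| - 2) * 2 ^ nedges e)
               * (2 * c) ^ (nedges e - 1)) * Rpower (INR n / ln (INR n)) s)%R ->
  ~ br_arrows e (@Knn n) N.
Proof.
set p := #|T|; set q := nedges e => eS p3 q0 s_def c_def N0 n3 n_large.
set M := 2 * _ * _ * _; set C := (/ _)%R; set x := (INR n / ln (INR n))%R => N_le.
have p1 : (1 <= INR p - 2)%R by have /leP/le_INR := p3; rewrite /=; lra.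
have q1 : (1 <= INR q)%R by have /leP/le_INR := q0.
have s0 : (0 <= s)%R.
  by apply: (Rmult_le_reg_r (INR p - 2)); lra.
have c4 : (4 <= c)%R by lra.
have rn3 : (3 <= INR n)%R by have /leP/le_INR := n3; rewrite /=; lra.
have ln1 := ln_ge1 rn3; set l := ln (INR n) in x N_le ln1 *.
have xl : (x * l = INR n)%R by rewrite /x; field; lra.
have sqrt_large : (4 * c <= sqrt (INR n))%R.
  rewrite -(sqrt_pow2 (4 * c)); last lra.
  by apply: sqrt_le_1_alt; lra.
have sqrt2 : (sqrt (INR n) * sqrt (INR n) = INR n)%R by apply: sqrt_sqrt; lra.
(* From [ln n <= 2 sqrt n] one gets [x >= sqrt n / 2 >= 2 c], so [x / c >= 2] and a suitable integer
   [K] exists. *)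
have x_large : (2 * c <= x)%R.
  have l_le : (l <= 2 * sqrt (INR n))%R by apply: ln_le_double_sqrt; lra.
  apply: (Rmult_le_reg_r l); first lra.
  by rewrite xl -sqrt2; nra.
have x0 : (0 < x)%R by lra.
have x_le_n : (x <= INR n)%R by rewrite -xl; nra.
(* The lower bound on [K] serves the red inequality, the upper bound the blue one. *)
have [K [K_ge K_le]] : exists K : nat, (x / c / 2 <= INR K <= x / c)%R.
  apply: nat_floor_half; apply: (Rmult_le_reg_r c); first lra.
  by have -> : (x / c * c = x)%R by field; lra.
have Kc_le : (INR K * c <= x)%R.
  by have := Rmult_le_compat_r c _ _ _ K_le; have -> : (x / c * c = x)%R; [field; lra|]; lra.
have K_ge' : (x / (2 * c) <= INR K)%R.
  by have <- : (x / c / 2 = x / (2 * c))%R; [field; lra|].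
have K0' : (0 < INR K)%R.
  by apply: Rlt_le_trans K_ge'; apply: Rdiv_lt_0_compat; lra.
have K0 : 0 < K by apply/ltP/INR_lt.
have n0 : 0 < n by apply: leq_trans n3.
have M2 : (2 <= INR M)%R.
  apply: (le_INR 2); apply/leP.
  by rewrite /M -!mulnA leq_pmulr // !muln_gt0 !expn_gt0; lia.
have D1 : (1 <= (2 * c) ^ (q - 1))%R by apply: pow_R1_Rle; lra.
have MD0 : (0 < INR M * (2 * c) ^ (q - 1))%R by nra.
have C0 : (0 < C)%R by apply: Rinv_0_lt_compat.
have C1 : (2 * C <= 1)%R.
  have CD : (C * (INR M * (2 * c) ^ (q - 1)) = 1)%R by apply: Rinv_l; lra.
  have D2 : (2 <= INR M * (2 * c) ^ (q - 1))%R by nra.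
  by have := Rmult_le_compat_l C _ _ (Rlt_le _ _ C0) D2; lra.
have y0 : (0 < Rpower x s)%R by apply: exp_pos.
have rN0 : (0 < INR N)%R by apply: lt_0_INR; apply/ltP.
apply: (@not_br_arrows_Knn _ _ _ _ K) => //; rewrite -?/p -?/q.
  have -> : 2 * (p ^ 2 * (N + N) ^ (p - 2)) * 2 ^ q = M * N ^ (p - 2).
    by rewrite addnn -mul2n expnMn /M; lia.
  apply: leq_INR; rewrite mult_INR !INR_expn.
  apply: (@Rle_trans _ ((x / (2 * c)) ^ (q - 1))); last first.
    apply: pow_incr; split => //.
    by apply/Rlt_le/Rdiv_lt_0_compat; lra.
  have powN : (INR N ^ (p - 2) <= C * x ^ (q - 1))%R.
    apply: (@Rle_trans _ ((C * Rpower x s) ^ (p - 2))); first by apply: pow_incr; lra.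
    rewrite Rpow_mult_distr -[(Rpower x s ^ _)%R]Rpower_pow // Rpower_mult.
    have -> : (s * INR (p - 2) = INR (q - 1))%R.
      by rewrite !minus_INR /=; [lra | apply/leP | apply/leP; apply: ltnW].
    rewrite Rpower_pow //; apply: Rmult_le_compat_r; first exact/Rlt_le/pow_lt.
    (* One factor [C] is kept to cancel the constants; the other [p - 3] are at most 1. *)
    have -> : p - 2 = (p - 3).+1 by lia.
    rewrite /= -[X in (_ <= X)%R]Rmult_1_r; apply: Rmult_le_compat_l; first lra.
    by rewrite -(pow1 (p - 3)); apply: pow_incr; lra.
  apply: Rle_trans (Rmult_le_compat_l _ _ _ (pos_INR M) powN) _.
  rewrite /Rdiv Rpow_mult_distr pow_inv.
  by apply: Req_le; rewrite /C; field; split; [lra | lra].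
apply: blue_count_le => //.
have ln2K : (ln (INR (2 * K)) <= l)%R.
  apply: ln_le; first by apply: lt_0_INR; apply/ltP; lia.
  by rewrite mult_INR [INR 2]/=; nra.
(* [2 * C <= 1] absorbs the doubling in [N + N], and [x <= n]. *)
have ln2N : (ln (INR (N + N)) <= s * l)%R.
  apply: (@Rle_trans _ (ln (Rpower x s))).
    by apply: ln_le; rewrite plus_INR; nra.
  by rewrite ln_Rpower; apply: Rmult_le_compat_l => //; apply: ln_le.
have n2K : (INR n * (c * l) <= INR (n * n) / INR K)%R.
  apply: (Rmult_le_reg_r (INR K)) => //.
  have -> : (INR (n * n) / INR K * INR K = INR n * INR n)%R by rewrite mult_INR; field; lra.
  have : (INR K * c * l <= INR n)%R by rewrite -xl; apply: Rmult_le_compat_r; lra.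
  by move=> h; have := Rmult_le_compat_l (INR n) _ _ (pos_INR n) h; lra.
(* What remains is [l + 2 n s l <= c n l]; as [c = 2 s + 4], the spare [4 n l] covers [l]. *)
apply: Rle_trans n2K; rewrite [INR (n + n)]plus_INR.
have := Rmult_le_compat_l (INR n) _ _ (pos_INR n) ln2N.
have : (l <= INR n * l)%R by nra.
by rewrite c_def => ? ?; lra.
Qed.

Theorem theorem1 (T : finType) (e : rel T) :
  simple_graph e -> bipartite e -> 3 <= nverts T ->
  exists C : R, (0 < C)%R /\
    exists n0 : nat, forall n : nat, n0 <= n ->
      br_gt e (@Knn n)
        (C * Rpower (INR n / ln (INR n))
                    ((INR (nedges e) - 1) / (INR (nverts T) - 2)))%R.
Proof.
move=> eS _ p3.
have p1 : (1 <= INR (nverts T) - 2)%R by have /leP/le_INR := p3; rewrite /=; lra.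
set s := (_ / _)%R.
have s_def : (s * (INR (nverts T) - 2) = INR (nedges e) - 1)%R by rewrite /s; field; lra.
have T0 : 0 < #|T| by apply: leq_trans p3.
(* Without edges the exponent [s] is negative, so the bound is at most [1 / 2] and only [N = 0] is
   concerned. *)
have [q0|q0] := posnP (nedges e).
  exists (1 / 2)%R; split; first lra.
  exists 3 => n n3 N N_le.
  have rn3 : (3 <= INR n)%R by have /leP/le_INR := n3; rewrite /=; lra.
  have ln1 := ln_ge1 rn3.
  have x1 : (1 <= INR n / ln (INR n))%R.
    apply: (Rmult_le_reg_r (ln (INR n))); first lra.
    have -> : (INR n / ln (INR n) * ln (INR n) = INR n)%R by field; lra.
    by have := exp_ineq1_le (ln (INR n)); rewrite exp_ln; lra.
  have s_neg : (s <= 0)%R by rewrite q0 /= in s_def; nra.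
  have := Rle_Rpower _ _ _ x1 s_neg; rewrite Rpower_O; last lra.
  move=> pow1.
  have -> : N = 0.
    case: N N_le => // N; rewrite S_INR; have := pos_INR N; lra.
  by apply: not_br_arrows0 => //; apply: leq_trans n3.
pose c := (2 * (s + 2))%R.
have s0 : (0 <= s)%R.
  have q1 : (1 <= INR (nedges e))%R by have /leP/le_INR := q0.
  by apply: (Rmult_le_reg_r (INR (nverts T) - 2)); lra.
have M0 : (0 < INR (2 * #|T| ^ 2 * 2 ^ (#|T| - 2) * 2 ^ nedges e))%R.
  by apply: lt_0_INR; apply/ltP; rewrite !muln_gt0 !expn_gt0 T0.
have c0 : (0 < 2 * c)%R by rewrite /c; lra.
(* The first factor collects the constants of the red inequality; [(2 * c) ^ (nedges e - 1)] pays
   for [K >= x / (2 c)]. *)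
exists (/ (INR (2 * #|T| ^ 2 * 2 ^ (#|T| - 2) * 2 ^ nedges e)
           * (2 * c) ^ (nedges e - 1)))%R; split.
  by apply/Rinv_0_lt_compat/Rmult_lt_0_compat => //; apply: pow_lt.
have [n0 n0_large] := INR_unbounded (16 * c ^ 2).
exists (maxn 3 n0) => n; rewrite geq_max => /andP[n3 nn0] N N_le.
(* [N = 0] is split off because the blue estimate takes the logarithm of [N + N]. *)
have [->|N0] := posnP N; first by apply: not_br_arrows0 => //; apply: leq_trans n3.
apply: (not_br_arrows_large eS p3 q0 s_def (erefl c) N0 n3 _ N_le).
by have /leP/le_INR := nn0; lra.
Qed.
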